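(* Let $G$ be a finitely generated group and let $S\subset G$ be a finite symmetric generating set of $G$. If the growth of $G$ is exponential, in other words if $$\lim_{n\to\infty}\frac{\ln\left(|B_S(n)|\right)}{n}>0,$$ then $$C(G,S)=\frac{\liminf_{n\to\infty}\frac{\ln(\text{Føl}_S(n))}{n}}{\lim_{n\to\infty}\frac{\ln\left(|B_S(n)|\right)}{n}}$$ (an equality in $[0,\infty]$).
   Context: $|A|$ denotes the cardinality of a set $A$. For $x\in G$, $|x|_S=\min\{n\ge 0:\exists g_1,\dots,g_n\in S,\ x=g_1\cdots g_n\}$ (the empty product is the identity $e$). For real $r\ge 0$, $B_S(r)=\{x\in G:|x|_S\leq r\}$, and balls of negative radius are empty. The limit $\lim_{n\to\infty}\ln(|B_S(n)|)/n$ always exists and is finite (Fekete's lemma). $\Phi_S[v]=\inf\{r:|B_S(r)|>v\}$, with $\inf\emptyset=\infty$ and the convention $c/\infty=0$. For $\Omega\subset G$, $\partial_S\Omega=\{x\in\Omega:\exists s\in S,\ xs\in G\setminus\Omega\}$. In what follows $\Omega$ always ranges over finite non-empty subsets of $G$. The constant $C(G,S)$ is $$C(G,S)=\sup\left\{c\geq 0:\exists \alpha\geq 0\text{ such that }\forall\Omega\subset G,\ \frac{|\partial_S\Omega|}{|\Omega|}\geq c\,\frac{1}{\Phi_S[(1+\alpha)|\Omega|]}\right\}.$$ The Følner function of $G$ relative to $S$ is $\text{Føl}_S(n)=\min\left\{|\Omega|:\Omega\subset G,\ \frac{|\partial_S\Omega|}{|\Omega|}\leq\frac{1}{n}\right\}$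 for integers $n\geq 1$, equal to $\infty$ if no such $\Omega$ exists (with $\ln\infty=\infty$). *)

(* Defs.v *)
From HB Require Import structures.
From mathcomp Require Import all_boot all_order all_algebra finmap.
From mathcomp Require Import all_classical all_reals all_analysis.

Set Implicit Arguments.
Unset Strict Implicit.
Unset Printing Implicit Defensive.

Import Order.TTheory GRing.Theory Num.Theory.
Import numFieldNormedType.Exports.

Local Open Scope classical_set_scope.
Local Open Scope ring_scope.

(* Meaningful only for finite [A]: [fset_set A] is empty when [A] is infinite. *)
Definition set_card (T : choiceType) (A : set T) : nat := #|` fset_set A|%fset.

(* Infimum in [\bar R] of a set of natural numbers: its minimum if it is
   nonempty ([emin_min]), and [+oo] if it is empty ([emin0]). *)
Definition emin (R : realType) (A : set nat) : \bar R :=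
  ereal_inf [set n%:R%:E | n in A].

Lemma emin_min (R : realType) (A : set nat) (n : nat) :
  A n -> (forall m, A m -> (n <= m)%N) -> emin R A = n%:R%:E.
Proof.
move=> An minn; apply/eqP; rewrite eq_le; apply/andP; split.
  by apply: ereal_inf_lbound; exists n.
by apply: le_ereal_inf_tmp => _ [m Am <-]; rewrite lee_fin ler_nat minn.
Qed.

Lemma emin0 (R : realType) : emin R set0 = +oo%E.
Proof. by rewrite /emin image_set0 ereal_inf0. Qed.

Definition subgroup (G : groupType) (H : set G) : Prop :=
  [/\ H 1%g, forall x y, H x -> H y -> H (x * y)%g
    & forall x, H x -> H (x^-1)%g].

Definition generates (G : groupType) (S : set G) : Prop :=
  smallest (@subgroup G) S = [set: G].

Definition symmetric_set (G : groupType) (S : set G) : Prop :=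
  forall s, S s -> S (s^-1)%g.

Definition word_norm (R : realType) (G : groupType) (S : set G) (x : G) :
    \bar R :=
  emin R [set n | exists g : 'I_n -> G,
    (forall i, S (g i)) /\ x = \big[*%g/1%g]_(i < n) g i].

(* Empty when [r < 0], since word norms are nonnegative. *)
Definition ball_S (R : realType) (G : groupType) (S : set G) (r : R) : set G :=
  [set x | (word_norm R S x <= r%:E)%E].

Definition growth_rate (R : realType) (G : groupType) (S : set G) : R :=
  limn (fun n : nat => ln (set_card (ball_S S (n%:R : R)))%:R / n%:R : R).

Definition Phi (R : realType) (G : groupType) (S : set G) (v : R) : \bar R :=
  ereal_inf [set r%:E | r in [set r : R | v < (set_card (ball_S S r))%:R]].

Definition boundary (G : groupType) (S Omega : set G) : set G :=
  [set x | Omega x /\ exists2 s, S s & ~ Omega (x * s)%g].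

Definition boundary_ratio (R : realType) (G : groupType) (S Omega : set G) : R :=
  (set_card (boundary S Omega))%:R / (set_card Omega)%:R.

(* In [\bar R], [c%:E / +oo = 0].  Moreover [Phi S v >= 1] for [v >= 1], so the
   division below is never by [0]. *)
Definition isoperimetric_constant (R : realType) (G : groupType) (S : set G) :
    \bar R :=
  ereal_sup [set c%:E | c in [set c : R | 0 <= c /\
    exists2 alpha : R, 0 <= alpha &
      forall Omega : set G, finite_set Omega -> Omega !=set0 ->
        (c%:E / Phi S ((1 + alpha) * (set_card Omega)%:R)
          <= (boundary_ratio R S Omega)%:E)%E]].

(* Only the values at [n >= 1] are meaningful. *)
Definition Folner (R : realType) (G : groupType) (S : set G) (n : nat) :
    \bar R :=
  emin R [set set_card Omega | Omega in [set Omega : set G |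
    [/\ finite_set Omega, Omega !=set0
      & boundary_ratio R S Omega <= 1 / n%:R]]].

(* Main.v *)
Require Import Defs.
From HB Require Import structures.
From mathcomp Require Import all_boot all_order all_algebra finmap.
From mathcomp Require Import all_classical all_reals all_analysis.
From mathcomp Require Import lra.

Import Order.TTheory GRing.Theory Num.Theory.
Import numFieldNormedType.Exports.

Local Open Scope classical_set_scope.
Local Open Scope ring_scope.

(** Write [b(r) = |B_S(r)|], let [lambda] be the growth rate and let [L] be the
lower limit of [ln Fol(n) / n].  The idea is that [Phi] inverts [b], which
behaves like [e^(lambda r)], so that [Phi(v)] behaves like [ln v / lambda]: the
isoperimetric inequality with constant [c] says that a set [Omega] with
boundary ratio about [1/n] satisfies [ln |Omega| >= lambda c n] up to an additive
constant, which in turn bounds [Fol(n)] from below.  The factor [1 + alpha] is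
what absorbs that additive constant, and every estimate is therefore needed
only up to a multiplicative constant.

Two equivalences turn the infima into universally quantified inequalities:
[Phi(v) >= y] iff [b(r) <= v] for all [r < y] ([Phi_geP]), and [Fol(n) >= x] iff
every admissible [Omega] has at least [x] elements ([Folner_geP]).  The growth
rate enters only through [b(n) >= e^(mu n) / K] for [mu < lambda]
([growth_lower]) and [b(r) <= K e^(mu r)] for [mu > lambda] ([growth_upper]).

- [C <= L / lambda].  If the inequality holds with [c > 0] and [alpha], a set
  [Omega] of ratio at most [1/n] has [Phi((1 + alpha)|Omega|) >= c n], hence
  [(1 + alpha)|Omega| >= b(m)] with [m] an integer just below [c n], and
  [b(m) >= e^(mu (c n - 2)) / K] with [mu] as close to [lambda] as desired
  ([isoperimetric_constant_le]).
- [C >= L / lambda].  If [c lambda < d < L], then [Fol(n) >= e^(d n)] for large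
  [n].  Given [Omega] of ratio [rho], necessarily positive since [Omega] would
  otherwise be admissible for every [n], apply this with [n] the integer part
  of [1/rho]: for [r < c / rho < c (n + 1)],
  [b(r) <= K e^((d/c) r) <= K e^(d (n + 1)) <= K e^d |Omega|].  The finitely
  many small [n] only affect the choice of [alpha]
  ([isoperimetric_constant_ge]). *)

(** * Extended reals and lower limits *)

Section Generalities.
Variable R : realType.
Implicit Types (c d r x : R) (y z : \bar R) (u : (\bar R)^nat).

Lemma ereal_between y z : (y < z)%E -> exists r, (y < r%:E < z)%E.
Proof.
case: y z => [y| |] [z| |] //=.
- rewrite lte_fin => yz; exists ((y + z) / 2); rewrite !lte_fin; lra.
- by move=> _; exists (y + 1); rewrite lte_fin ltry andbT ltrDl.
- by move=> _; exists (z - 1); rewrite ltNyr lte_fin /= ltrBlDr ltrDl.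
- by move=> _; exists 0; rewrite ltNyr ltry.
Qed.

(** The hypothesis asks for an eventual lower bound only by each [d < x], so that
exponential estimates may lose a constant factor. *)
Lemma limn_einf_ge u x :
  (forall d, d < x -> \forall n \near \oo, (d%:E <= u n)%E) ->
  (x%:E <= limn_einf u)%E.
Proof.
move=> ux; rewrite leNgt; apply/negP => /ereal_between[d /andP[]] /[swap].
rewrite lte_fin => /ux ud; apply/negP; rewrite -leNgt.
rewrite /limn_einf -/(limf_einf u \oo) limf_einfE.
apply: le_ereal_sup_tmp; exists (ereal_inf (u @` [set n | (d%:E <= u n)%E])).
  by exists [set n | (d%:E <= u n)%E].
by apply: le_ereal_inf_tmp => _ [n /= dn <-].
Qed.

Lemma limn_einf_gt u x :
  (x%:E < limn_einf u)%E -> \forall n \near \oo, (x%:E <= u n)%E.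
Proof.
rewrite /limn_einf -/(limf_einf u \oo) limf_einfE.
move=> /ereal_sup_gt[_ [V Voo <-] /ltW xV].
apply: filterS Voo => n Vn; apply: (le_trans xV).
by apply: ereal_inf_lbound; exists n.
Qed.

(** Solves the isoperimetric inequality [c / Phi <= rho] for [Phi].  It also
covers the degenerate values [y = 0] and [y = +oo], since [c / 0 = +oo] and
[c / +oo = 0] in the extended reals. *)
Lemma lee_divC c x y : 0 < c -> 0 < x -> (0 <= y)%E ->
  (c%:E / y <= x%:E)%E = ((c / x)%:E <= y)%E.
Proof.
move=> c0 x0; case: y => [y| |]; last by rewrite leeNy_eq.
  2: by rewrite invey mule0 !leey lee_fin (ltW x0).
rewrite lee_fin inver; have [-> _|y0 y_ge0] := eqVneq y 0.
  by rewrite mulry gtr0_sg// mul1e lee_fin leye_eq/= [RHS]leNgt divr_gt0.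
rewrite -EFinM !lee_fin ler_pdivrMr ?lt_neqAle ?y_ge0 1?eq_sym ?y0//.
by rewrite ler_pdivrMr// mulrC.
Qed.

Lemma lee_lne_expR d y : (d%:E <= lne y)%E = ((expR d)%:E <= y)%E.
Proof.
case: y => [y| |] /=; [|by rewrite !leey|by rewrite !leeNy_eq].
case: ifPn => [y0|].
  rewrite leeNy_eq/= lee_fin; apply/esym/negbTE.
  by rewrite -ltNge (le_lt_trans y0) ?expR_gt0.
by rewrite -ltNge => y0; rewrite !lee_fin -[in RHS](lnK y0) ler_expR.
Qed.

Lemma near_le_expR d x : 0 < d -> \forall n \near \oo, x <= expR (d * n%:R).
Proof.
move=> d0; near=> n; apply: le_trans (expR_ge1Dx _).
apply: (@le_trans _ _ (d * n%:R)); last by rewrite lerDr.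
by rewrite -ler_pdivrMl//; near: n; exact: nbhs_infty_ger.
Unshelve. all: by end_near. Qed.

End Generalities.

(** * Cardinality of sets *)

Section Cardinals.
Variable T : choiceType.
Implicit Types A B : set T.

Lemma le_set_card A B : finite_set B -> A `<=` B -> (set_card A <= set_card B)%N.
Proof.
move=> finB AB; apply: fsubset_leq_card.
by rewrite -fset_set_sub//; exact: sub_finite_set AB finB.
Qed.

Lemma set_card0 : set_card (@set0 T) = 0%N.
Proof. by rewrite /set_card fset_set0 cardfs0. Qed.

Lemma set_card_gt0 A : finite_set A -> A !=set0 -> (0 < set_card A)%N.
Proof.
move=> finA [x Ax]; rewrite /set_card cardfs_gt0; apply/fset0Pn; exists x.
by rewrite in_fset_set// inE.
Qed.

End Cardinals.

(** * Balls of the word metric *)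

Section Balls.
Variables (R : realType) (G : groupType) (S : set G).
Implicit Types (r x v : R) (n : nat) (Omega : set G).

Definition words n : set G := [set x | exists g : 'I_n -> G,
  (forall i, S (g i)) /\ x = \big[*%g/1%g]_(i < n) g i].

(** Makes balls concrete: the word norm is an infimum of natural numbers, so a
real bound on it is witnessed by an actual word. *)
Lemma ball_SP r (x : G) : ball_S S r x <-> exists2 n, words n x & n%:R <= r.
Proof.
split; last first.
  move=> [n wn nr]; apply: (@le_trans _ _ n%:R%:E); last by rewrite lee_fin.
  by apply: ereal_inf_lbound; exists n.
have [r0|r0] := leP 0 r => xr.
  have /ereal_inf_lt[_ [n wn <-]] :
      (word_norm R S x < (Num.truncn r).+1%:R%:E)%E.
    by apply: le_lt_trans xr _; rewrite lte_fin truncnS_gt.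
  rewrite lte_fin ltr_nat ltnS truncn_ge_nat// => nr.
  by exists n.
have /ereal_inf_lt[_ [n wn <-]] : (word_norm R S x < 0)%E.
  by apply: le_lt_trans xr _; rewrite lte_fin.
by rewrite lte_fin ltrn0.
Qed.

Lemma ball_S_neg r : r < 0 -> ball_S S r = set0.
Proof.
move=> r0; rewrite -subset0 => x /ball_SP[n _ nr].
by have := le_lt_trans nr r0; rewrite ltrn0.
Qed.

Lemma finite_words n : finite_set S -> finite_set (words n).
Proof.
move=> finS; elim: n => [|n IHn].
  apply: (sub_finite_set _ (finite_set1 (1%g : G))) => _ [g [_ ->]].
  by rewrite big_ord0.
apply: (sub_finite_set _ (finite_image (fun p : G * G => (p.1 * p.2)%g)
  (finite_setX IHn finS))) => _ [g [Sg ->]].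
rewrite big_ord_recr/=; pose h i := g (widen_ord (leqnSn n) i).
exists (\big[*%g/1%g]_(i < n) h i, g ord_max) => //.
by split; [exists h; split => // i; exact: Sg|exact: Sg].
Qed.

Lemma finite_ball_S r : finite_set S -> finite_set (ball_S S r).
Proof.
move=> finS; apply: (@sub_finite_set _ _
  (\bigcup_(n in `I_(Num.truncn r).+1) words n)).
  move=> x /ball_SP[n wn nr]; exists n => //=.
  by rewrite ltnS truncn_ge_nat// (le_trans _ nr).
by apply: bigcup_finite => // n _; exact: finite_words.
Qed.

Lemma ball_S_gt0 n : finite_set S -> (0 < set_card (ball_S S (n%:R : R)))%N.
Proof.
move=> finS; apply: set_card_gt0; first exact: finite_ball_S.
exists 1%g; apply/ball_SP; exists 0%N => //.
exists (fun=> 1%g); split; first by case.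
by rewrite big_ord0.
Qed.

Lemma le_ball_S r r' : finite_set S -> r <= r' ->
  (set_card (ball_S S r) <= set_card (ball_S S r'))%N.
Proof.
move=> finS rr'; apply: le_set_card; first exact: finite_ball_S.
by move=> x /ball_SP[n wn nr]; apply/ball_SP; exists n => //; exact: le_trans rr'.
Qed.

Lemma ball_S_trunc r : 0 <= r -> ball_S S r = ball_S S ((Num.truncn r)%:R : R).
Proof.
move=> r0; apply/seteqP.
split => x /ball_SP[n wn nr]; apply/ball_SP; exists n => //.
  by rewrite ler_nat truncn_ge_nat.
by apply: le_trans nr _; rewrite truncn_le.
Qed.

(** * The functions inverted by the growth: Phi and Folner *)

(** [Phi] is a generalized inverse of the nondecreasing function
[r |-> |B_S(r)|]. *)
Lemma Phi_geP v r :
  (r%:E <= Phi S v)%E <-> forall r', r' < r -> (set_card (ball_S S r'))%:R <= v.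
Proof.
split=> [rPhi r' r'r|br].
  rewrite leNgt; apply/negP => vb; have : (Phi S v <= r'%:E)%E.
    by apply: ereal_inf_lbound; exists r'.
  by move=> /(le_trans rPhi); rewrite lee_fin leNgt r'r.
apply: le_ereal_inf_tmp => _ [r' /= vb <-]; rewrite lee_fin leNgt; apply/negP.
by move=> /br; rewrite leNgt vb.
Qed.

Lemma Phi_ge0 v : 0 <= v -> (0 <= Phi S v)%E.
Proof. by move=> v0; apply/Phi_geP => r r0; rewrite ball_S_neg// set_card0. Qed.

Lemma Folner_geP x n : (x%:E <= Folner R S n)%E <->
  forall Omega, finite_set Omega -> Omega !=set0 ->
    boundary_ratio R S Omega <= n%:R^-1 -> x <= (set_card Omega)%:R.
Proof.
split=> [xF Om finO O0 On|xO].
  rewrite -lee_fin; apply: le_trans xF _; apply: ereal_inf_lbound.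
  by exists (set_card Om) => //; exists Om => //; split; rewrite ?div1r.
apply: le_ereal_inf_tmp => _ [_ [Om [finO O0 On] <-] <-].
by rewrite lee_fin; apply: xO => //; rewrite -[leRHS]div1r.
Qed.

Lemma boundary_ratio_ge0 Omega : 0 <= boundary_ratio R S Omega.
Proof. by rewrite divr_ge0. Qed.

(** * Exponential growth and the isoperimetric constant *)

Section Growth.
Hypothesis finS : finite_set S.
Hypothesis exp_growth : 0 < growth_rate R S.

Let b n : R := (set_card (ball_S S (n%:R : R)))%:R.

(** The limit of a sequence that does not converge is by convention the default
element of [R], which is [0]; a positive growth rate is thus a genuine limit. *)
Lemma cvg_growth_rate : ln (b n) / n%:R @[n --> \oo] --> growth_rate R S.
Proof.
suff : cvgn (fun n => ln (b n) / n%:R : R) by [].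
apply: contrapT => /dvgP dvg.
by move: exp_growth; rewrite /growth_rate dvg ltxx.
Qed.

(** The constant makes the asymptotic bound hold at every [n], since all balls
are nonempty and [e^(mu n)] is bounded on the finitely many exceptions. *)
Lemma growth_lower mu : 0 <= mu -> mu < growth_rate R S ->
  exists2 K : R, 0 < K & forall n, expR (mu * n%:R) <= K * b n.
Proof.
move=> mu0 /(cvgr_gt _ cvg_growth_rate)[N _ bN].
have b_ge1 n : 1 <= b n by rewrite ler1n; exact: ball_S_gt0.
exists (expR (mu * N%:R)); first exact: expR_gt0.
move=> n; have [Nn|nN] := leqP N n; last first.
  rewrite (@le_trans _ _ (expR (mu * N%:R)))//; last by rewrite ler_peMr ?expR_ge0.
  by rewrite ler_expR ler_wpM2l// ler_nat ltnW.
apply: (@le_trans _ _ (b n)); last first.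
  by rewrite ler_peMl ?(le_trans ler01)// -expR0 ler_expR mulr_ge0.
rewrite -[leRHS]lnK ?posrE ?(lt_le_trans ltr01)// ler_expR.
have [->|n0] := posnP n; first by rewrite mulr0 ln_ge0.
by rewrite -ler_pdivlMr ?ltr0n// ltW// bN.
Qed.

(** Stated for real radii, as is needed to bound [Phi] from below; rounding
[r] down costs nothing because [mu > 0]. *)
Lemma growth_upper mu : growth_rate R S < mu ->
  exists2 K : R, 0 < K & forall r, (set_card (ball_S S r))%:R <= K * expR (mu * r).
Proof.
move=> mu_gt; have mu0 : 0 < mu := lt_trans exp_growth mu_gt.
have [N _ bN] := cvgr_lt _ cvg_growth_rate _ mu_gt.
have b_gt0 n : 0 < b n by rewrite ltr0n; exact: ball_S_gt0.
have K0 : 0 < 1 + b N by rewrite addr_gt0.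
exists (1 + b N) => // r; have [r0|r0] := leP 0 r; last first.
  by rewrite ball_S_neg// set_card0 mulr_ge0 ?expR_ge0 ?ltW.
rewrite ball_S_trunc// -/(b _); set n := Num.truncn r.
apply: (@le_trans _ _ ((1 + b N) * expR (mu * n%:R))); last first.
  by rewrite ler_pM2l// ler_expR ler_pM2l// truncn_le.
have [nN|Nn] := leqP n N.
  apply: (@le_trans _ _ (b N)); first by rewrite ler_nat le_ball_S// ler_nat.
  rewrite -[leLHS]mulr1 ler_pM// ?lerDr//.
  by rewrite -[leLHS]expR0 ler_expR mulr_ge0// ltW.
have n0 : (0 < n)%N := leq_ltn_trans (leq0n N) Nn.
rewrite -[leLHS]mul1r ler_pM// ?lerDl//.
rewrite ltW//.
by rewrite -[ltLHS]lnK ?posrE// ltr_expR -ltr_pdivrMr ?ltr0n// bN//= ltnW.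
Qed.

Let L := limn_einf (fun n : nat => lne (Folner R S n) / n%:R%:E)%E.

Lemma lee_lne_Folner d n : (0 < n)%N ->
  (d%:E <= lne (Folner R S n) / n%:R%:E)%E =
  ((expR (d * n%:R))%:E <= Folner R S n)%E.
Proof.
move=> n0; rewrite inver pnatr_eq0 gtn_eqF//.
by rewrite lee_pdivlMr ?ltr0n// -EFinM lee_lne_expR.
Qed.

(** An isoperimetric inequality with constant [c] forces exponential growth of
the Folner function at rate at least [c] times that of the group. *)
Lemma isoperimetric_constant_le (c alpha : R) : 0 <= c -> 0 <= alpha ->
  (forall Omega : set G, finite_set Omega -> Omega !=set0 ->
    (c%:E / Phi S ((1 + alpha) * (set_card Omega)%:R)
      <= (boundary_ratio R S Omega)%:E)%E) ->
  ((c * growth_rate R S)%:E <= L)%E.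
Proof.
move=> c_ge0 alpha0 isop; apply: limn_einf_ge => d dc.
have [d_le0|d0] := leP d 0.
  near=> n; have n0 : (0 < n)%N by near: n; exact: nbhs_infty_gt.
  rewrite lee_lne_Folner//; apply/Folner_geP => Om finO O0 _.
  apply: (@le_trans _ _ 1); last by rewrite ler1n set_card_gt0.
  by rewrite -[leRHS]expR0 ler_expR mulr_le0_ge0.
have c0 : 0 < c.
  rewrite lt_neqAle c_ge0 andbT; apply: contraTneq (lt_trans d0 dc) => <-.
  by rewrite mul0r ltxx.
pose mu := (d / c + growth_rate R S) / 2.
have dc_lt : d / c < growth_rate R S by rewrite ltr_pdivrMr// mulrC.
have dc_gt0 : 0 < d / c by rewrite divr_gt0.
have mu0 : 0 <= mu by rewrite /mu; lra.
have [K K0 bK] : exists2 K, 0 < K & forall n, expR (mu * n%:R) <= K * b n.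
  by apply: growth_lower => //; rewrite /mu; lra.
have e0 : 0 < mu * c - d.
  by rewrite subr_gt0 -ltr_pdivrMr// /mu; lra.
(* The gap [mu * c - d > 0] lets [expR ((mu * c - d) * n)] absorb the constant
   [A] below for large [n]. *)
near=> n; have n0 : (0 < n)%N by near: n; exact: nbhs_infty_gt.
rewrite lee_lne_Folner//; apply/Folner_geP => Om finO O0 On.
have cn0 : 0 < c * n%:R by rewrite mulr_gt0// ltr0n.
have Phi_ge : ((c * n%:R)%:E <= Phi S ((1 + alpha) * (set_card Om)%:R))%E.
  rewrite -[n%:R]invrK -lee_divC ?invr_gt0 ?ltr0n//; last first.
    by rewrite Phi_ge0 ?mulr_ge0 ?addr_ge0.
  by apply: le_trans (isop Om finO O0) _; rewrite lee_fin.
(* The radius has to be strictly below [c * n], hence the predecessor: the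
   integer part may equal [c * n]. *)
pose m := (Num.truncn (c * n%:R)).-1.
have [m_lt m_ge] : m%:R < c * n%:R /\ c * n%:R <= m%:R + 2.
  have := truncn_itv (ltW cn0); rewrite /m.
  case: (Num.truncn _) => [|k] /andP[k1 k2] /=; first by lra.
  by move: k1 k2; rewrite -!natr1; lra.
have bm : b m <= (1 + alpha) * (set_card Om)%:R by move/Phi_geP: Phi_ge; apply.
pose A := K * (1 + alpha) * expR (mu * 2).
have A0 : 0 < A by rewrite !mulr_gt0 ?expR_gt0// ltr_pwDl.
rewrite -(ler_pM2l A0).
apply: (@le_trans _ _ (expR (mu * (c * n%:R)))).
  apply: (@le_trans _ _ (expR ((mu * c - d) * n%:R) * expR (d * n%:R))).
    rewrite ler_pM2r ?expR_gt0//; near: n; exact: near_le_expR.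
  by rewrite -expRD -mulrDl subrK mulrA.
apply: (@le_trans _ _ (expR (mu * m%:R) * expR (mu * 2))).
  by rewrite -expRD -mulrDr ler_expR ler_wpM2l.
rewrite /A [leRHS]mulrAC ler_pM2r ?expR_gt0//.
by apply: le_trans (bK m) _; rewrite -mulrA ler_pM2l.
Unshelve. all: by end_near. Qed.

(** Conversely, a Folner function growing strictly faster than
[e^(c lambda n)] yields the inequality with constant [c], the strictness being
spent on replacing [b(r)] by a pure exponential. *)
Lemma isoperimetric_constant_ge (c : R) : 0 < c ->
  ((c * growth_rate R S)%:E < L)%E ->
  exists2 alpha : R, 0 <= alpha &
    forall Omega : set G, finite_set Omega -> Omega !=set0 ->
      (c%:E / Phi S ((1 + alpha) * (set_card Omega)%:R)
        <= (boundary_ratio R S Omega)%:E)%E.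
Proof.
move=> c0 /ereal_between[d /andP[]]; rewrite lte_fin => cd /limn_einf_gt[N _ FN].
have d0 : 0 < d by apply: lt_trans cd; rewrite mulr_gt0.
have [K K0 bK] : exists2 K, 0 < K &
    forall r, (set_card (ball_S S r))%:R <= K * expR (d / c * r).
  by apply: growth_upper; rewrite ltr_pdivlMr// mulrC.
have F n Om : (N < n)%N -> finite_set Om -> Om !=set0 ->
    boundary_ratio R S Om <= n%:R^-1 -> expR (d * n%:R) <= (set_card Om)%:R.
  move=> Nn; move: Om; apply/Folner_geP.
  rewrite -lee_lne_Folner ?(leq_ltn_trans _ Nn)//.
  by apply: FN; exact: ltnW.
(* Large enough both for ratios above [1 / (N + 1)], where nothing is known
   about [|Om|], and for the factor [K * expR d] in the other case. *)
pose alpha := K * expR (d * N.+1%:R).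
have alpha0 : 0 <= alpha by rewrite mulr_ge0 ?expR_ge0// ltW.
exists alpha => // Om finO O0.
have O1 : 1 <= (set_card Om)%:R :> R by rewrite ler1n set_card_gt0.
(* A set without boundary would be admissible for every [n], although its
   cardinality is fixed and the Folner function is unbounded. *)
have rho0 : 0 < boundary_ratio R S Om.
  rewrite lt_neqAle boundary_ratio_ge0 andbT; apply/negP => /eqP rho0.
  have [M _ /(_ (N + M).+1)] := near_le_expR _ _ ((set_card Om)%:R + 1) d0.
  rewrite /= (leq_trans (leq_addl N M))// => /(_ isT).
  apply/negP; rewrite -ltNge ltr_pwDr// F ?ltnS ?leq_addr//.
  by rewrite -rho0 invr_ge0.
set rho := boundary_ratio R S Om in rho0 *.
rewrite lee_divC//; last by rewrite Phi_ge0// mulr_ge0 ?addr_ge0.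
apply/Phi_geP => r r_lt; apply: le_trans (bK r) _.
pose n := Num.truncn rho^-1.
have /andP[n_le n_gt] := truncn_itv (ltW (divr_gt0 ltr01 rho0)).
rewrite !div1r -/n in n_le n_gt.
have {}bK : K * expR (d / c * r) <= K * expR (d * n.+1%:R).
  rewrite ler_pM2l// ler_expR -mulrA ler_pM2l// mulrC ler_pdivrMr//.
  by rewrite mulrC (le_trans (ltW r_lt))// ler_pM2l// ltW.
apply: le_trans bK _.
apply: (@le_trans _ _ (alpha * (set_card Om)%:R)); last first.
  by rewrite ler_wpM2r// lerDr.
have [nN|Nn] := leqP n N.
  rewrite -[leLHS]mulr1 ler_pM ?ler01 ?mulr_ge0 ?expR_ge0 ?(ltW K0)//.
  by rewrite /alpha ler_pM2l// ler_expR ler_pM2l// ler_nat.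
have n0 : (0 < n)%N := leq_ltn_trans (leq0n N) Nn.
rewrite -natr1 mulrDr mulr1 addrC expRD mulrA.
rewrite ler_pM ?F ?mulr_ge0 ?expR_ge0 ?(ltW K0)//.
  by rewrite /alpha ler_pM2l// ler_expR ler_peMr ?ler1n // ltW.
by rewrite -/rho -[rho]invrK lef_pV2 ?posrE ?invr_gt0 ?ltr0n.
Qed.

End Growth.

End Balls.

Theorem theorem3p9 (R : realType) (G : groupType) (S : set G)
    (finS : finite_set S) (symS : symmetric_set S) (genS : generates S)
    (exp_growth : 0 < growth_rate R S) :
  isoperimetric_constant R S =
    (limn_einf (fun n : nat => lne (Folner R S n) / n%:R%:E)
      / (growth_rate R S)%:E)%E.
Proof.
rewrite inver gt_eqF//; apply/eqP; rewrite eq_le; apply/andP; split.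
  apply: ge_ereal_sup => _ [c [c0 [alpha alpha0 isop]] <-].
  by rewrite lee_pdivlMr// -EFinM; exact: isoperimetric_constant_le isop.
rewrite leNgt; apply/negP => /ereal_between[c /andP[Cc cL]].
have C0 : (0 <= isoperimetric_constant R S)%E.
  apply: ereal_sup_ubound; exists 0 => //; split => //; exists 0 => // Om _ _.
  by rewrite mul0e lee_fin boundary_ratio_ge0.
have c0 : 0 < c by rewrite -lte_fin (le_lt_trans C0).
have : (c%:E <= isoperimetric_constant R S)%E.
  apply: ereal_sup_ubound; exists c => //; split; first exact: ltW.
  by apply: isoperimetric_constant_ge => //; rewrite EFinM -lte_pdivlMr.
by rewrite leNgt Cc.
Qed.
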